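(* There exists a Jónsson–Tarski algebra with universe $\omega$ which is a Jónsson algebra.
   Context: A Jónsson–Tarski algebra is an algebra $\langle A;\cdot,\ell,r\rangle$ with a binary operation $\cdot$ and unary operations $\ell,r$ satisfying the identities $\ell(x\cdot y)=x$, $r(x\cdot y)=y$, $\ell(z)\cdot r(z)=z$. A Jónsson algebra is an infinite algebra in a countable algebraic language which has no proper subalgebra of the same cardinality as itself. *)

(* Defs.v *)
From mathcomp Require Import all_boot.
From mathcomp Require Import boolp classical_sets functions cardinality.

Set Implicit Arguments.
Unset Strict Implicit.
Unset Printing Implicit Defensive.

Local Open Scope classical_set_scope.
Local Open Scope card_scope.

Record language := Language {
  symbol : Type;
  arity : symbol -> nat }.

Definition algebra (L : language) (A : Type) :=
  forall f : symbol L, (arity f).-tuple A -> A.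

Definition subalgebra (L : language) (A : Type) (M : algebra L A) (X : set A) :=
  forall (f : symbol L) (t : (arity f).-tuple A),
    (forall i, X (tnth t i)) -> X (M f t).

Definition jonsson_algebra (L : language) (A : Type) (M : algebra L A) :=
  [/\ infinite_set [set: A],
      countable [set: symbol L] &
      ~ exists X : set A, [/\ subalgebra M X, X `<` [set: A] & X #= [set: A]]].

Inductive jt_symbol := jt_mul | jt_l | jt_r.

Definition jt_language : language :=
  Language (fun f => match f with jt_mul => 2 | jt_l => 1 | jt_r => 1 end).

Definition jonsson_tarski_algebra (A : Type) (M : algebra jt_language A) :=
  let mul x y := M jt_mul [tuple x; y] in
  let l x := M jt_l [tuple x] in
  let r x := M jt_r [tuple x] in
  [/\ forall x y, l (mul x y) = x,
      forall x y, r (mul x y) = y &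
      forall z, mul (l z) (r z) = z].

(* Main.v *)
Require Import Defs.
From Stdlib Require Cantor.
From mathcomp Require Import all_boot zify.
From mathcomp Require Import boolp classical_sets functions cardinality.

(** Cantor's pairing has [(0, 0) = 0] and [(1, 0) = 1], while both components
    of any [n >= 2] are smaller than [n] and not both zero.  Hence projecting
    repeatedly leads from any nonzero element down to [1], and [1] generates
    [0] by a projection and then every [n] by strong induction.  So the only
    possible proper subalgebras are the empty set and [{0}]. *)

Local Open Scope classical_set_scope.

Definition cantor_algebra : algebra jt_language nat :=
  fun f => match f return (@arity jt_language f).-tuple nat -> nat with
    | jt_mul => fun t => Cantor.to_nat (tnth t ord0, tnth t ord_max)
    | jt_l => fun t => (Cantor.of_nat (tnth t ord0)).1
    | jt_r => fun t => (Cantor.of_nat (tnth t ord0)).2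
    end.

Local Arguments Cantor.to_nat : simpl never.
Local Arguments Cantor.of_nat : simpl never.

Lemma cantor_algebra_jonsson_tarski : jonsson_tarski_algebra cantor_algebra.
Proof.
(* Passing from [tnth] to [nth] lets the entries of the literal tuples compute. *)
split=> /= [x y|x y|z]; rewrite /cantor_algebra !(tnth_nth 0) /=.
- by rewrite Cantor.cancel_of_to.
- by rewrite Cantor.cancel_of_to.
- by rewrite -surjective_pairing Cantor.cancel_to_of.
Qed.

(** With [s = a + b], Cantor's formula reads [2 * n = 2 * b + s * (s + 1)]. The bound on [n] is
    sharp: [1] decodes to [(1, 0)], whose first component does not decrease. *)
Lemma cantor_unpair_lt n a b : 1 < n -> Cantor.of_nat n = (a, b) ->
  [/\ a < n, b < n & 0 < a + b].
Proof.
move=> n_gt1 /(congr1 Cantor.to_nat); rewrite Cantor.cancel_to_of => nE.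
by have := Cantor.to_nat_spec a b; rewrite -nE => spec; split; nia.
Qed.

Lemma cantor_subalgebra_total (X : set nat) n :
  subalgebra cantor_algebra X -> X n -> 0 < n -> X = [set: nat].
Proof.
move=> subX Xn n_gt0.
have Xmul a b : X a -> X b -> X (Cantor.to_nat (a, b)).
  move=> Xa Xb; have := subX jt_mul [tuple a; b].
  rewrite /cantor_algebra !(tnth_nth 0) /=; apply=> i.
  by rewrite (tnth_nth 0); case: i => [[|[|]]].
have Xl m : X m -> X (Cantor.of_nat m).1.
  move=> Xm; have := subX jt_l [tuple m].
  by rewrite /cantor_algebra (tnth_nth 0) /=; apply=> i; rewrite ord1.
have Xr m : X m -> X (Cantor.of_nat m).2.
  move=> Xm; have := subX jt_r [tuple m].
  by rewrite /cantor_algebra (tnth_nth 0) /=; apply=> i; rewrite ord1.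
have X1 : X 1.
  elim/ltn_ind: n Xn n_gt0 => n IH Xn n_gt0.
  have [n_le1|n_gt1] := leqP n 1; first by have -> : 1 = n by lia.
  case nE: (Cantor.of_nat n) => [a b].
  have [a_lt b_lt ab_gt0] := cantor_unpair_lt n a b n_gt1 nE.
  (* The descent must follow a nonzero component: [0] decodes to [(0, 0)] and generates only
     itself. *)
  have [a0|a_gt0] := posnP a.
    by apply: (IH b) => //; [have := Xr n Xn; rewrite nE | lia].
  by apply: (IH a) => //; have := Xl n Xn; rewrite nE.
apply/seteqP; split=> // m _.
(* Since [1] decodes to [(1, 0)], its right projection yields [0]; from [2] on, each number is a
   product of smaller ones. *)
elim/ltn_ind: m => -[_|[//|m IH]]; first exact: (Xr 1 X1).
rewrite -(Cantor.cancel_to_of m.+2).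
case mE: (Cantor.of_nat m.+2) => [a b].
by have [a_lt b_lt _] := cantor_unpair_lt m.+2 a b isT mE; apply: Xmul; apply: IH.
Qed.

Lemma cantor_algebra_jonsson : jonsson_algebra cantor_algebra.
Proof.
split.
- exact: infinite_nat.
- apply/countable_injP.
  exists (fun f => match f with jt_mul => 0 | jt_l => 1 | jt_r => 2 end).
  by move=> [] [].
- move=> [X [subX [_ XNT] XT]]; apply: infinite_nat.
  (* Finiteness passes along the bijection, so it suffices to confine [X] to [{0}]: a nonzero member
     would contradict properness. *)
  rewrite -(eq_finite_set XT); apply: sub_finite_set (finite_set1 0) => n Xn.
  have [//|n_gt0] := posnP n; case: XNT.
  by rewrite (cantor_subalgebra_total X n subX Xn n_gt0).
Qed.

Theorem theorem4p1 :
  exists M : algebra jt_language nat,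
    jonsson_tarski_algebra M /\ jonsson_algebra M.
Proof.
by exists cantor_algebra; split;
  [exact: cantor_algebra_jonsson_tarski | exact: cantor_algebra_jonsson].
Qed.
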